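(* Let $\mu_x,\mu_y>0$, $L_{xy}>0$, and $$q = 1+\frac{2\mu_x\mu_y}{L_{xy}^2} - 2\sqrt{\Big(\frac{\mu_x\mu_y}{L_{xy}^2}\Big)^2 + \frac{\mu_x\mu_y}{L_{xy}^2}}.$$ Consider the problem instance in $\mathcal{B}(L_{xy},\mu_x,\mu_y)$ $$\min_{x\in\mathbb{R}^n}\max_{y\in\mathbb{R}^n} F(x,y)=\frac{\mu_x}{2}\|x\|^2 + \frac{L_{xy}}{2}x^\top Ay - \frac{\mu_y}{2}\|y\|^2 - b^\top y,$$ with $n\geq \max\big\{2\log_q\big(\tfrac{\mu_x\mu_y}{\sqrt{2}L_{xy}^2}\big),\,4k\big\}$, $A$ as defined in the context, $b=-\frac{L_{xy}^2}{4\mu_x}e_1$, and saddle point $(x^*,y^* )$. If an approximate solution $(\tilde x^k,\tilde y^k)\in\mathcal{H}_x^k\times\mathcal{H}_y^k$ generated after $k$ iterations by the proximal algorithm class (with linear span) started at $x^0=y^0=0$ is required to have duality gap $\max_y F(\tilde x^{k},y) - \min_{x} F(x, \tilde y^k)\le\epsilon$, then the number of iterations needed is at least $$k\geq \frac{\ln\left(\frac{\mu_y\|y^*-y^0\|^2}{32\epsilon}\right)}{\ln(q^{-1})} = \Omega\left(\sqrt{\frac{L_{xy}^2}{\mu_x\mu_y}}\cdot\ln\left(\frac{1}{\epsilon}\right)\right).$$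
   Context: Class $\mathcal{B}(L_{xy},\mu_x,\mu_y)$: problems $\min_x\max_y F(x,y)=f(x)+x^\top Cy-g(y)$ with $f,g$ lower semicontinuous, $f$ $\mu_x$-strongly convex, $g$ $\mu_y$-strongly convex, and $\|C\|_2\le L_{xy}$. For $\gamma,\sigma>0$: $\mathbf{prox}_{\gamma f}(v)=\arg\min_x f(x)+\frac{1}{2\gamma}\|x-v\|^2$ and $\mathbf{prox}_{\sigma g}(u)=\arg\min_y g(y)+\frac{1}{2\sigma}\|y-u\|^2$. Proximal algorithm class (with linear span): for such a problem, iterates $(x^k,y^k)_{k\ge0}$ are generated so that $(x^k,y^k)\in\mathcal{H}_x^k\times\mathcal{H}_y^k$, where $\mathcal{H}_x^0=\mathrm{Span}\{x^0\}$, $\mathcal{H}_y^0=\mathrm{Span}\{y^0\}$ and $$\mathcal{H}_x^{k+1}=\mathrm{Span}\{x^i,\ \mathbf{prox}_{\gamma_i f}(\hat x^i-\gamma_i C\tilde y^i):\ \hat x^i\in\mathcal{H}_x^i,\ \tilde y^i\in\mathcal{H}_y^i,\ 0\le i\le k\},$$ $$\mathcal{H}_y^{k+1}=\mathrm{Span}\{y^i,\ \mathbf{prox}_{\sigma_i g}(\hat y^i+\sigma_i C^\top\tilde x^i):\ \tilde x^i\in\mathcal{H}_x^i,\ \hat y^i\in\mathcal{H}_y^i,\ 0\le i\le k\},$$ with arbitrary step sizes $\gamma_i,\sigma_i>0$. For the instance in the claim, $f(x)=\frac{\mu_x}{2}\|x\|^2$, $g(y)=\frac{\mu_y}{2}\|y\|^2+b^\top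 y$, $C=\frac{L_{xy}}{2}A$. The matrix $A\in\mathbb{R}^{n\times n}$ is: $A_{i,n+1-i}=1$ for $1\le i\le n$, $A_{i,n+2-i}=-1$ for $2\le i\le n$, all other entries $0$. The vector $e_1$ is the first standard basis vector. Convention: in the $\Omega$ bound, absolute constants are hidden, $\epsilon\to0$, and the factor $\mu_y\|y^*-y^0\|^2$ inside the logarithm is suppressed; i.e. $1/\ln(q^{-1})=\Omega\big(\sqrt{L_{xy}^2/(\mu_x\mu_y)}\big)$. *)

(* Defs.v *)
From HB Require Import structures.
From mathcomp Require Import all_boot all_order all_algebra.
From mathcomp Require Import all_classical all_reals all_analysis.

Set Implicit Arguments.
Unset Strict Implicit.
Unset Printing Implicit Defensive.

Import Order.TTheory GRing.Theory Num.Theory.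
Import numFieldNormedType.Exports.

Local Open Scope classical_set_scope.
Local Open Scope ring_scope.

(* The norm `|x| that the library puts on matrices is the max norm, hence
   separate definitions of the Euclidean and spectral norms. *)
Definition dot (R : realType) (n : nat) (u v : 'cV[R]_n) : R :=
  (u^T *m v) 0 0.

Definition enorm (R : realType) (n : nat) (u : 'cV[R]_n) : R :=
  Num.sqrt (dot u u).

Definition opnorm2 (R : realType) (n m : nat) (C : 'M[R]_(n, m)) : R :=
  sup [set enorm (C *m y) | y in [set y : 'cV[R]_m | enorm y <= 1]].

Definition proper (R : realType) (T : Type) (f : T -> \bar R) : Prop :=
  (forall x, f x != -oo%E) /\ (exists x, f x \is a fin_num).

Definition strongly_convex (R : realType) (n : nat) (mu : R)
    (f : 'cV[R]_n -> \bar R) : Prop :=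
  forall (x y : 'cV[R]_n) (t : R), 0 < t < 1 ->
    (f (t *: x + (1 - t) *: y)%R + (mu / 2 * (t * (1 - t)) * enorm (x - y) ^+ 2)%:E
     <= t%:E * f x + (1 - t)%:E * f y)%E.

(* min_x max_y f(x) + x^T C y - g(y) belongs to B(Lxy, mu_x, mu_y); as usual
   for proximal methods, f and g may take the value +oo. *)
Definition in_class_B (R : realType) (n m : nat) (Lxy mu_x mu_y : R)
    (f : 'cV[R]_n -> \bar R) (g : 'cV[R]_m -> \bar R) (C : 'M[R]_(n, m)) : Prop :=
  [/\ proper f /\ proper g,
      lower_semicontinuous f /\ lower_semicontinuous g,
      strongly_convex mu_x f,
      strongly_convex mu_y g
    & opnorm2 C <= Lxy].

(* When f x = g y = +oo the library convention gives the value -oo, which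
   leaves max_y F(x, y) and min_x F(x, y) as expected for proper f and g. *)
Definition bilinear_obj (R : realType) (n m : nat)
    (f : 'cV[R]_n -> \bar R) (g : 'cV[R]_m -> \bar R) (C : 'M[R]_(n, m))
    (x : 'cV[R]_n) (y : 'cV[R]_m) : \bar R :=
  (f x + (dot x (C *m y))%:E - g y)%E.

Definition saddle_point (R : realType) (X Y : Type) (F : X -> Y -> \bar R)
    (xs : X) (ys : Y) : Prop :=
  forall x y, (F xs y <= F xs ys)%E /\ (F xs ys <= F x ys)%E.

Definition duality_gap (R : realType) (X Y : Type) (F : X -> Y -> \bar R)
    (x : X) (y : Y) : \bar R :=
  (ereal_sup (range (F x)) - ereal_inf (range (F ^~ y)))%E.

Definition argmin (R : realType) (T : Type) (h : T -> \bar R) : set T :=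
  [set p | forall z, (h p <= h z)%E].

Definition prox (R : realType) (n : nat) (gamma : R) (f : 'cV[R]_n -> \bar R)
    (v : 'cV[R]_n) : set 'cV[R]_n :=
  argmin (fun x => f x + ((2 * gamma)^-1 * enorm (x - v) ^+ 2)%:E)%E.

(* Linear span of a possibly infinite set. *)
Definition lspan (R : realType) (n : nat) (S : set 'cV[R]_n) : set 'cV[R]_n :=
  [set v | exists2 s : seq 'cV[R]_n, {in s, forall u, S u} & v \in << s >>%VS].

(* x and y are iterates of a method of the proximal class (with linear span)
   with step sizes gamma and sigma, and Hx, Hy are the associated subspaces:
   the generators range over all points of the earlier subspaces. *)
Record proximal_span_run (R : realType) (n m : nat)
    (f : 'cV[R]_n -> \bar R) (g : 'cV[R]_m -> \bar R) (C : 'M[R]_(n, m))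
    (gamma sigma : nat -> R) (x : nat -> 'cV[R]_n) (y : nat -> 'cV[R]_m)
    (Hx : nat -> set 'cV[R]_n) (Hy : nat -> set 'cV[R]_m) : Prop :=
  ProximalSpanRun {
    gamma_gt0 : forall i, 0 < gamma i;
    sigma_gt0 : forall i, 0 < sigma i;
    Hx_init : Hx 0%N = lspan [set x 0%N];
    Hy_init : Hy 0%N = lspan [set y 0%N];
    Hx_step : forall k, Hx k.+1 = lspan (\bigcup_(i in `I_k.+1)
      ([set x i] `|` [set u | exists xh yt, [/\ Hx i xh, Hy i yt &
         prox (gamma i) f (xh - gamma i *: (C *m yt)) u]]));
    Hy_step : forall k, Hy k.+1 = lspan (\bigcup_(i in `I_k.+1)
      ([set y i] `|` [set u | exists xt yh, [/\ Hx i xt, Hy i yh &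
         prox (sigma i) g (yh + sigma i *: (C^T *m xt)) u]]));
    x_in_Hx : forall k, Hx k (x k);
    y_in_Hy : forall k, Hy k (y k)
  }.

(* Indices start at 0: the entries 1 satisfy i + j = n - 1, the entries -1
   satisfy i + j = n. *)
Definition Amx (R : realType) (n : nat) : 'M[R]_n :=
  \matrix_(i < n, j < n)
    if (i + j).+1 == n then 1 else if (i + j)%N == n then -1 else 0.

Definition e1 (R : realType) (n : nat) : 'cV[R]_n :=
  \col_(i < n) if i == 0%N :> nat then 1 else 0.

Definition inst_b (R : realType) (n : nat) (mu_x Lxy : R) : 'cV[R]_n :=
  - (Lxy ^+ 2 / (4 * mu_x)) *: e1 R n.

Definition inst_f (R : realType) (n : nat) (mu_x : R) (x : 'cV[R]_n) : \bar R :=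
  (mu_x / 2 * enorm x ^+ 2)%:E.

Definition inst_g (R : realType) (n : nat) (mu_x mu_y Lxy : R)
    (y : 'cV[R]_n) : \bar R :=
  (mu_y / 2 * enorm y ^+ 2 + dot (inst_b n mu_x Lxy) y)%:E.

Definition inst_C (R : realType) (n : nat) (Lxy : R) : 'M[R]_n :=
  (Lxy / 2) *: Amx R n.

Definition inst_F (R : realType) (n : nat) (mu_x mu_y Lxy : R) :
    'cV[R]_n -> 'cV[R]_n -> \bar R :=
  bilinear_obj (@inst_f R n mu_x) (inst_g mu_x mu_y Lxy) (inst_C n Lxy).

Definition rate_q (R : realType) (mu_x mu_y Lxy : R) : R :=
  1 + 2 * mu_x * mu_y / Lxy ^+ 2
  - 2 * Num.sqrt ((mu_x * mu_y / Lxy ^+ 2) ^+ 2 + mu_x * mu_y / Lxy ^+ 2).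

Definition logb (R : realType) (b x : R) : R := ln x / ln b.

Definition iter_bound (R : realType) (n : nat) (mu_x mu_y Lxy eps : R)
    (ys y0 : 'cV[R]_n) : R :=
  ln (mu_y * enorm (ys - y0) ^+ 2 / (32 * eps)) / ln (rate_q mu_x mu_y Lxy)^-1.

(* Main.v *)
Require Import Defs.
From HB Require Import structures.
From mathcomp Require Import all_boot all_order all_algebra.
From mathcomp Require Import all_classical all_reals all_analysis.
From mathcomp Require Import zify ring lra.

Import Order.TTheory GRing.Theory Num.Theory.
Import numFieldNormedType.Exports.

Local Open Scope classical_set_scope.
Local Open Scope ring_scope.

(* On this instance a prox step is affine: it multiplies one block by A and, in
   y only, adds a multiple of e_0.  Since A maps e_j to e_(n-1-j) - e_(n-j)
   (indices from 0, e_n = 0), H_y^k lies in the span of the first ceil(k/2) basis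
   vectors and H_x^k in that of the last floor(k/2).  Eliminating x from the
   saddle point (xs, ys) leaves a three-term recurrence for ys, with solution
   proportional to q^i - q^(2n-i); hence the coordinates out of reach weigh at
   least a fraction of order q^k of |ys|^2 in
   F(x,ys) - F(xs,y) = mu_x/2 |x - xs|^2 + mu_y/2 |y - ys|^2,
   a lower bound for the duality gap. *)

(** * The Euclidean inner product *)

Section EuclideanDot.
Context {R : realType} {n : nat}.
Implicit Types u v w : 'cV[R]_n.

Lemma dotE u v : dot u v = \sum_i u i 0 * v i 0.
Proof. by rewrite /dot mxE; apply: eq_bigr => i _; rewrite mxE. Qed.

Lemma dotC u v : dot u v = dot v u.
Proof. by rewrite !dotE; apply: eq_bigr => i _; rewrite mulrC. Qed.

Lemma dotDr u v w : dot u (v + w) = dot u v + dot u w.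
Proof. by rewrite /dot mulmxDr mxE. Qed.

Lemma dotZr a u v : dot u (a *: v) = a * dot u v.
Proof. by rewrite /dot -scalemxAr mxE. Qed.

Lemma dotNr u v : dot u (- v) = - dot u v.
Proof. by rewrite -scaleN1r dotZr mulN1r. Qed.

Lemma dotDl u v w : dot (u + v) w = dot u w + dot v w.
Proof. by rewrite dotC dotDr !(dotC w). Qed.

Lemma dotZl a u v : dot (a *: u) v = a * dot u v.
Proof. by rewrite dotC dotZr dotC. Qed.

Lemma dotNl u v : dot (- u) v = - dot u v.
Proof. by rewrite dotC dotNr dotC. Qed.

Lemma dot0l u : dot 0 u = 0.
Proof. by rewrite -(scale0r 0) dotZl mul0r. Qed.

Definition dot_linear := (dotDl, dotDr, dotNl, dotNr, dotZl, dotZr).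

Lemma dot_ge0 u : 0 <= dot u u.
Proof. by rewrite dotE; apply: sumr_ge0 => i _; rewrite -expr2 sqr_ge0. Qed.

Lemma dot_eq0 u : dot u u = 0 -> u = 0.
Proof.
rewrite dotE => /psumr_eq0P u0; apply/colP => i; rewrite mxE.
by apply/eqP; rewrite -sqrf_eq0 expr2 u0// => j _; rewrite -expr2 sqr_ge0.
Qed.

Lemma sqr_enorm u : enorm u ^+ 2 = dot u u.
Proof. by rewrite sqr_sqrtr// dot_ge0. Qed.

Lemma dot_mulmx_sym (A : 'M[R]_n) u v : A^T = A ->
  dot u (A *m v) = dot (A *m u) v.
Proof. by move=> sA; rewrite /dot trmx_mul sA mulmxA. Qed.

End EuclideanDot.

(** * Strongly convex quadratics and their proximal maps *)

Section Quadratic.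
Context {R : realType} {n : nat}.
Variables (p : R) (b : 'cV[R]_n).
Hypothesis p_gt0 : 0 < p.

Definition quad (x : 'cV[R]_n) : R := p / 2 * enorm x ^+ 2 + dot b x.

Lemma strongly_convex_quad : strongly_convex p (EFin \o quad).
Proof.
move=> x y t _; rewrite /quad /= -!EFinM -!EFinD lee_fin !sqr_enorm.
rewrite !dot_linear (dotC y x) le_eqVlt; apply/orP; left; apply/eqP.
by field.
Qed.

Lemma continuous_quad : continuous quad.
Proof.
have cD (c : 'cV[R]_n -> 'I_n -> R) :
    (forall i, continuous (c ^~ i)) -> continuous (fun x => \sum_i c x i).
  move=> cc x; apply: (@cvg_big _ _ _ _ _ _ _ (nbhs x)) => [|i _].
    exact: add_continuous.
  exact: cc.
have -> : quad = fun x : 'cV[R]_n =>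
    p / 2 * (\sum_i x i 0 * x i 0) + \sum_i b i 0 * x i 0.
  by apply/funext => x; rewrite /quad sqr_enorm !dotE.
have cM (c d : 'cV[R]_n -> R) :
    continuous c -> continuous d -> continuous (fun x => c x * d x).
  by move=> cc cd x; exact: cvgM (cc x) (cd x).
have cK (a : R) : continuous (fun _ : 'cV[R]_n => a) by exact: cst_continuous.
have cE (i : 'I_n) : continuous (fun x : 'cV[R]_n => x i 0).
  exact: coord_continuous.
have cS1 := cD _ (fun i => cM _ _ (cE i) (cE i)).
have cS2 := cD _ (fun i => cM _ _ (cK (b i 0)) (cE i)).
move=> x; exact: cvgD (cM _ _ (cK (p / 2)) cS1 x) (cS2 x).
Qed.

Lemma lower_semicontinuous_quad : lower_semicontinuous (EFin \o quad).
Proof.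
apply/lower_semicontinuousP => a.
have -> : [set x | (a%:E < (EFin \o quad) x)%E] = quad @^-1` [set y | a < y].
  by apply/seteqP; split => x /=; rewrite lte_fin.
by apply: open_comp => [x _|]; [apply: continuous_quad|exact: open_gt].
Qed.

Lemma proper_quad : Defs.proper (EFin \o quad).
Proof. by split=> //; exists 0. Qed.

(* Completing the square: [w] is the point where the gradient of the proximal
   objective vanishes. *)
Lemma prox_quad (gamma : R) (v u : 'cV[R]_n) : 0 < gamma ->
  prox gamma (EFin \o quad) v u ->
  u = (1 + gamma * p)^-1 *: (v - gamma *: b).
Proof.
move=> g0 umin; have gp : 0 < 1 + gamma * p by rewrite addr_gt0// mulr_gt0.
have [w wE] : {w | w = (1 + gamma * p)^-1 *: (v - gamma *: b)} by eexists.
rewrite -wE; have := umin w.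
rewrite /= -!EFinD lee_fin /quad !sqr_enorm.
have -> : v = (1 + gamma * p) *: w + gamma *: b.
  by rewrite wE scalerA divff ?gt_eqF// scale1r subrK.
rewrite !dot_linear (dotC b w) (dotC u w) (dotC b u).
move=> le_uw; apply/eqP; rewrite -subr_eq0; apply/eqP/dot_eq0.
apply/eqP; rewrite eq_le dot_ge0 andbT !dot_linear (dotC u w).
(* The objective values at [u] and [w] differ by exactly half of [gamma^-1 * (1 + gamma * p)] times
   |u - w|^2. *)
have g1 : gamma^-1 * (1 + gamma * p) > 0 by rewrite mulr_gt0 ?invr_gt0.
rewrite -(pmulr_rle0 _ g1); move: le_uw; rewrite -subr_le0 => le_uw.
rewrite -(pmulr_rle0 _ (_ : 0 < 2^-1 :> R))//; apply: le_trans le_uw.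
rewrite le_eqVlt; apply/orP; left; apply/eqP; field.
by rewrite gt_eqF.
Qed.

End Quadratic.

(** * Action of A on coordinates and supports *)

Section Coordinates.
Context {R : realType} {n : nat}.
Implicit Types (v : 'cV[R]_n) (w : nat -> R) (D : pred nat).

(** The extra value [w n = 0] encodes e_n = 0, so that shifted indices up to [n] make sense. *)
Lemma cV_nat v : exists2 w : nat -> R, v = \col_(i < n) w i & w n = 0.
Proof.
exists (fun k => if insub k is Some j then v j 0 else 0).
  by apply/colP => i; rewrite mxE valK.
by rewrite insubF ?ltnn.
Qed.

Lemma trmx_Amx : (Amx R n)^T = Amx R n.
Proof. by apply/matrixP => i j; rewrite !mxE addnC. Qed.

(** Row [i] has its 1 in column n-1-i and its -1 in column n-i; for [i = 0] the latter column is
    missing, and [w] vanishes at [n]. *)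
Lemma mul_Amx w : w n = 0 ->
  Amx R n *m (\col_i w i) = \col_i (w (n - i.+1)%N - w (n - i)%N).
Proof.
move=> wn; apply/colP => i; rewrite !mxE.
transitivity (\sum_(j < n | j == (n - i.+1)%N :> nat) w j
              - \sum_(j < n | j == (n - i)%N :> nat) w j).
  rewrite [X in _ = X - _]big_mkcond [X in _ = _ - X]big_mkcond -sumrB; apply: eq_bigr => j _.
  rewrite !mxE; have := ltn_ord i; have := ltn_ord j => jn ni.
  have -> : ((i + j).+1 == n) = (j == n - i.+1 :> nat)%N by lia.
  have -> : ((i + j)%N == n) = (j == n - i :> nat)%N by lia.
  case: eqP => [->|_].
    by rewrite ifF ?subr0 ?mul1r//; lia.
  by case: eqP => _; rewrite ?subr0 ?mul0r// sub0r mulN1r.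
rewrite !big_ord1_eq ifT; last by have := ltn_ord i; lia.
case: ifP => // /negbT; rewrite -leqNgt => ni.
have -> : (n - i)%N = n by apply/eqP; rewrite eqn_leq leq_subr.
by rewrite wn.
Qed.

(** Up to reversing the rows, A is a difference operator on consecutive coordinates. *)
Lemma mul_Amx_rev w i : w n = 0 ->
  (Amx R n *m (\col_i w i)) (rev_ord i) 0 = w i - w i.+1.
Proof.
move=> wn; rewrite mul_Amx// mxE /=.
by congr (w _ - w _); have := ltn_ord i; lia.
Qed.

Lemma dot_rev v : dot v v = \sum_(i < n) v (rev_ord i) 0 ^+ 2.
Proof.
rewrite dotE (reindex_inj rev_ord_inj).
by apply: eq_bigr => i _; rewrite expr2.
Qed.

(** Each difference obeys (a - b)^2 <= 2 a^2 + 2 b^2, and shifting the index does not increase the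
    sum of squares because [w n = 0]. *)
Lemma dot_Amx_le v : dot (Amx R n *m v) (Amx R n *m v) <= 4 * dot v v.
Proof.
have [w -> wn] := cV_nat v; rewrite dot_rev.
have -> : dot (\col_(i < n) w i) (\col_i w i) = \sum_(i < n) w i ^+ 2.
  by rewrite dotE; apply: eq_bigr => i _; rewrite mxE expr2.
have shift : \sum_(i < n) w i.+1 ^+ 2 <= \sum_(i < n) w i ^+ 2.
  rewrite -(lerD2l (w 0%N ^+ 2)) -(big_ord_recl n (fun i => w i ^+ 2)).
  by rewrite big_ord_recr /= wn expr0n addr0 lerDr sqr_ge0.
have -> : 4 * \sum_(i < n) w i ^+ 2 =
    \sum_(i < n) 2 * w i ^+ 2 + 2 * \sum_(i < n) w i ^+ 2.
  by rewrite -mulr_sumr; ring.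
apply: (@le_trans _ _ (\sum_(i < n) 2 * w i ^+ 2 + 2 * \sum_(i < n) w i.+1 ^+ 2)).
  rewrite mulr_sumr -big_split; apply: ler_sum => i _ /=.
  rewrite mul_Amx_rev// -subr_ge0.
  by rewrite (_ : _ - _ = (w i + w i.+1) ^+ 2) ?sqr_ge0//; ring.
by rewrite lerD2l ler_pM2l.
Qed.

Definition supp D : set 'cV[R]_n :=
  [set v | forall i : 'I_n, ~~ D i -> v i 0 = 0].

Lemma suppD D v1 v2 : supp D v1 -> supp D v2 -> supp D (v1 + v2).
Proof. by move=> s1 s2 i Di; rewrite mxE s1// s2// addr0. Qed.

Lemma suppZ D a v : supp D v -> supp D (a *: v).
Proof. by move=> s i Di; rewrite mxE s// mulr0. Qed.

Lemma suppW D D' v : (forall i, D i -> D' i) -> supp D v -> supp D' v.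
Proof. by move=> sDD' s i D'i; apply: s; apply: contra D'i; exact: sDD'. Qed.

Lemma lspan_supp D (S : set 'cV[R]_n) : S `<=` supp D -> lspan S `<=` supp D.
Proof.
move=> SD v [s sS vs]; rewrite (@coord_span _ _ _ (in_tuple s) v)//.
elim/big_ind: _ => [i _|u w|j _]; first by rewrite mxE.
  exact: suppD.
by apply/suppZ/SD/sS; rewrite mem_nth.
Qed.

Lemma supp_Amx D D' v :
  (forall i, i < n -> D (n - i.+1) -> D' i)%N ->
  (forall i, 0 < i < n -> D (n - i) -> D' i)%N ->
  supp D v -> supp D' (Amx R n *m v).
Proof.
move=> D1 D2; have [w -> wn] := cV_nat v => s.
have w0 k : (k < n)%N -> ~~ D k -> w k = 0.
  by move=> kn /(s (Ordinal kn)); rewrite mxE.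
move=> i D'i; rewrite mul_Amx// mxE.
rewrite w0; [|by have := ltn_ord i; lia|by apply: contra D'i => /D1; apply].
have [i0|i0] := posnP i; first by rewrite i0 subn0 wn subr0.
rewrite w0 ?subr0; [by []|by have := ltn_ord i; lia|].
by apply: contra D'i; apply: D2; rewrite i0 /=.
Qed.

(** Outside [D] the vector [u] vanishes and [u - v] reduces to [- v]; the other coordinates
    contribute nonnegative squares. *)
Lemma dot_sub_supp D v u : supp D u ->
  \sum_(i < n | ~~ D i) v i 0 ^+ 2 <= dot (u - v) (u - v).
Proof.
move=> s; rewrite dotE [leRHS](bigID (fun i : 'I_n => D i)) /= -[leLHS]add0r.
apply: lerD; first by apply: sumr_ge0 => i _; rewrite -expr2 sqr_ge0.
apply: ler_sum => i Di; rewrite !mxE (s _ Di) le_eqVlt; apply/orP; left.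
by apply/eqP; ring.
Qed.

End Coordinates.

(** * Saddle point and duality gap of coupled quadratics *)

Section BilinearQuadratic.
Context {R : realType} {n : nat}.
Variables (p r : R) (b : 'cV[R]_n) (C : 'M[R]_n).
Hypotheses (p_gt0 : 0 < p) (r_gt0 : 0 < r).

Let F := bilinear_obj (EFin \o quad p 0) (EFin \o quad r b) C.
Let Fr x y := quad p 0 x + dot x (C *m y) - quad r b y.

Variables (x0 y0 : 'cV[R]_n).
Hypotheses (symC : C^T = C).
Hypotheses (grad_x : C *m y0 = - (p *: x0)) (grad_y : C *m x0 = r *: y0 + b).

(** The gradient equations at [(x0, y0)] cancel all linear and bilinear terms around that point,
    leaving two pure squares. *)
Lemma objective_gap x y : Fr x y0 - Fr x0 y =
  p / 2 * dot (x - x0) (x - x0) + r / 2 * dot (y - y0) (y - y0).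
Proof.
have by0 : dot b y0 = - p * dot x0 x0 - r * dot y0 y0.
  have -> : b = C *m x0 - r *: y0 by rewrite grad_y addrC addKr.
  by rewrite dotDl -dot_mulmx_sym// grad_x !dot_linear mulNr.
rewrite /Fr /quad !sqr_enorm (dot_mulmx_sym C x0)// grad_y grad_x !dot0l.
rewrite !dot_linear by0 (dotC x0 x) (dotC y y0).
by field.
Qed.

(** The saddle inequalities tested at [(x0, y0)] make the gap in [objective_gap] nonpositive, so
    both squares vanish. *)
Lemma saddle_point_unique xs ys : saddle_point F xs ys -> xs = x0 /\ ys = y0.
Proof.
move=> sp; have [+ _] := sp x0 y0; have [_ +] := sp x0 y0 => leR leL.
have := le_trans leL leR; rewrite lee_fin -subr_le0 objective_gap.
move=> gap_le0.
have p2 : 0 < p / 2 by rewrite divr_gt0.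
have r2 : 0 < r / 2 by rewrite divr_gt0.
have Dx := mulr_ge0 (ltW p2) (dot_ge0 (xs - x0)).
have Dy := mulr_ge0 (ltW r2) (dot_ge0 (ys - y0)).
have := paddr_eq0 Dx Dy; rewrite eq_le gap_le0 addr_ge0//= => /esym.
rewrite (mulf_eq0 (p / 2)) (mulf_eq0 (r / 2)) (gt_eqF p2) (gt_eqF r2) /= => /andP[/eqP/dot_eq0 + /eqP/dot_eq0].
by move=> /eqP + /eqP; rewrite !subr_eq0 => /eqP -> /eqP ->.
Qed.

(** The points [y0] and [x0] serve as test points in the supremum and the infimum. *)
Lemma duality_gap_ge x y eps : (duality_gap F x y <= eps%:E)%E ->
  p / 2 * dot (x - x0) (x - x0) + r / 2 * dot (y - y0) (y - y0) <= eps.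
Proof.
move=> gap_le; rewrite -objective_gap -lee_fin; apply: le_trans gap_le.
rewrite EFinB; apply: leeB.
  by apply: ereal_sup_ubound; exists y0.
by apply: ereal_inf_lbound; exists x0.
Qed.

End BilinearQuadratic.

(** * The instance: class membership and growth of the spans *)

Section Instance.
Context {R : realType} {n : nat}.
Variables (mu_x mu_y Lxy : R).
Hypotheses (mu_x_gt0 : 0 < mu_x) (mu_y_gt0 : 0 < mu_y) (Lxy_gt0 : 0 < Lxy).

Lemma inst_fE : inst_f mu_x = EFin \o quad mu_x (0 : 'cV[R]_n).
Proof.
by apply/funext => x; rewrite /inst_f /quad /= dot0l addr0.
Qed.

Lemma inst_gE : inst_g mu_x mu_y Lxy = EFin \o quad mu_y (inst_b n mu_x Lxy).
Proof. by []. Qed.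

Lemma trmx_inst_C : (inst_C n Lxy)^T = inst_C n Lxy.
Proof. by rewrite /inst_C linearZ /= trmx_Amx. Qed.

Lemma opnorm2_inst_C : opnorm2 (inst_C n Lxy) <= Lxy.
Proof.
apply: ge_sup; first by exists (enorm (inst_C n Lxy *m 0)), 0 => //=;
  rewrite /enorm dot0l sqrtr0.
move=> _ [y /= y1 <-]; have dy1 : dot y y <= 1.
  by rewrite -sqr_enorm expr_le1// sqrtr_ge0.
rewrite -[leRHS](ger0_norm (ltW Lxy_gt0)) -sqrtr_sqr; apply: ler_wsqrtr.
rewrite /inst_C.
rewrite -scalemxAl !dot_linear; have := dot_Amx_le y => dAy.
have L2 : 0 <= Lxy / 2 by rewrite divr_ge0// ltW.
rewrite mulrA -expr2; apply: (le_trans (ler_wpM2l (sqr_ge0 _) dAy)).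
have -> : (Lxy / 2) ^+ 2 * (4 * dot y y) = Lxy ^+ 2 * dot y y by field.
by rewrite ler_piMr// sqr_ge0.
Qed.

Lemma inst_in_class_B : in_class_B Lxy mu_x mu_y (@inst_f R n mu_x)
  (inst_g mu_x mu_y Lxy) (inst_C n Lxy).
Proof.
rewrite inst_fE inst_gE; split.
- by split; apply: proper_quad.
- by split; apply: lower_semicontinuous_quad.
- exact: strongly_convex_quad.
- exact: strongly_convex_quad.
- exact: opnorm2_inst_C.
Qed.

(* Each oracle call gains at most one coordinate: A swaps the two ends of the
   coordinate range and extends the support by one only from x to y. *)
Lemma span_run_supp gamma sigma x y Hx Hy :
  proximal_span_run (@inst_f R n mu_x) (inst_g mu_x mu_y Lxy) (inst_C n Lxy)
    gamma sigma x y Hx Hy -> x 0%N = 0 -> y 0%N = 0 ->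
  forall k, Hx k `<=` supp (fun i => n <= i + k./2)%N /\
            Hy k `<=` supp (fun i => i < uphalf k)%N.
Proof.
(* Strong induction, as the generators at stage [k.+1] come from all stages [i <= k]. *)
move=> run x0 y0; elim/ltn_ind => -[_|k IH].
  rewrite (Hx_init run) (Hy_init run) x0 y0.
  by split; apply: lspan_supp => _ -> i _; rewrite mxE.
have suppx (i j : nat) :
    (i <= k)%N -> (n <= j + i./2)%N -> (n <= j + k.+1./2)%N by lia.
have suppy (i j : nat) :
    (i <= k)%N -> (j < uphalf i)%N -> (j < uphalf k.+1)%N by lia.
rewrite (Hx_step run) (Hy_step run).
split; apply: lspan_supp => u [i /= ik] []; have [IHx IHy] := IH i ik.
- by move=> ->; apply: suppW (IHx _ (x_in_Hx run i)) => j; exact: suppx.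
- case=> [xh [yt [/IHx sx /IHy sy]]]; rewrite inst_fE => prx.
  rewrite (prox_quad _ _ mu_x_gt0 _ _ _ (gamma_gt0 run i) prx) scaler0 subr0.
  apply/suppZ/suppD; first by apply: suppW sx => j; exact: suppx.
  rewrite -scaleNr; apply: suppZ; rewrite -scalemxAl; apply: suppZ.
  by apply: supp_Amx sy => j; lia.
- by move=> ->; apply: suppW (IHy _ (y_in_Hy run i)) => j; exact: suppy.
- case=> [xt [yh [/IHx sx /IHy sy]]]; rewrite inst_gE => prx.
  rewrite (prox_quad _ _ mu_y_gt0 _ _ _ (sigma_gt0 run i) prx).
  apply/suppZ/suppD; first apply: suppD.
  + by apply: suppW sy => j; exact: suppy.
  + rewrite trmx_inst_C; apply: suppZ; rewrite -scalemxAl; apply: suppZ.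
    by apply: supp_Amx sx => j; lia.
  (* Here [b] is a multiple of e_0, and coordinate 0 is allowed because [uphalf k.+1] is
     positive. *)
  + rewrite -scaleNr; apply: suppZ; rewrite /inst_b; apply: suppZ => j.
    by rewrite -leqNgt mxE; case: eqP => // ->; lia.
Qed.

End Instance.

(** * The rate q and its logarithm *)

Section Rate.
Context {R : realType}.
Variables (mu_x mu_y Lxy : R).
Hypotheses (mu_x_gt0 : 0 < mu_x) (mu_y_gt0 : 0 < mu_y) (Lxy_gt0 : 0 < Lxy).

Let a := mu_x * mu_y / Lxy ^+ 2.
Let q := rate_q mu_x mu_y Lxy.
Let t := Num.sqrt (a ^+ 2 + a).

Let a_gt0 : 0 < a.
Proof. by rewrite divr_gt0 ?mulr_gt0 ?exprn_gt0. Qed.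

Let t2 : t ^+ 2 = a ^+ 2 + a.
Proof. by rewrite sqr_sqrtr// addr_ge0 ?sqr_ge0 ?ltW. Qed.

Let t_ge0 : 0 <= t. Proof. exact: sqrtr_ge0. Qed.

Let qE : q = 1 + 2 * a - 2 * t.
Proof. by rewrite /q /rate_q /t /a !mulrA. Qed.

(** Characteristic equation of the recurrence for [ysol]: q + q^-1 = 2 + 4 a. *)
Lemma rate_q_quadratic : 4 * (mu_x * mu_y / Lxy ^+ 2) * q = (1 - q) ^+ 2.
Proof.
rewrite -/a qE; apply/eqP; rewrite -subr_eq0; apply/eqP.
have -> : 4 * a * (1 + 2 * a - 2 * t) - (1 - (1 + 2 * a - 2 * t)) ^+ 2 =
  4 * (a ^+ 2 + a - t ^+ 2) by ring.
by rewrite t2 subrr mulr0.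
Qed.

(** The second factor is the other root of the same quadratic, whose roots have product 1. *)
Let q_conj : q * (1 + 2 * a + 2 * t) = 1.
Proof.
rewrite qE; have -> : (1 + 2 * a - 2 * t) * (1 + 2 * a + 2 * t) =
  1 + 4 * (a ^+ 2 + a - t ^+ 2) by ring.
by rewrite t2 subrr mulr0 addr0.
Qed.

Let q_conj_gt1 : 1 < 1 + 2 * a + 2 * t.
Proof. have := a_gt0; have := t_ge0; lra. Qed.

Lemma rate_q_gt0 : 0 < q.
Proof. by rewrite -(pmulr_lgt0 _ (lt_trans ltr01 q_conj_gt1)) q_conj. Qed.

Lemma rate_q_lt1 : q < 1.
Proof. by rewrite -q_conj ltr_pMr ?rate_q_gt0. Qed.

Lemma ln_rate_q_inv_gt0 : 0 < ln q^-1.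
Proof. by rewrite ln_gt0// invf_gt1 ?rate_q_gt0 ?rate_q_lt1. Qed.

(* [q^-1 = (s + sqrt (1 + s^2))^2 <= (1 + 2 s)^2], where [s = sqrt a]. *)
Lemma ln_rate_q_inv_le : ln q^-1 <= 4 * Num.sqrt a.
Proof.
set s := Num.sqrt a; have s0 : 0 <= s by exact: sqrtr_ge0.
have s2 : s ^+ 2 = a by rewrite sqr_sqrtr// ltW.
have tle : t <= a + s.
  rewrite -ler_sqr ?nnegrE ?t2//; last by rewrite addr_ge0// ltW.
  by rewrite sqrrD s2 [leRHS]addrAC lerDl mulrn_wge0// mulr_ge0// ltW.
have q1 : q^-1 <= (1 + 2 * s) ^+ 2.
  have q0 : q != 0 by rewrite lt0r_neq0// rate_q_gt0.
  have -> : q^-1 = 1 + 2 * a + 2 * t by apply: (mulfI q0); rewrite q_conj divff.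
  rewrite (_ : (1 + 2 * s) ^+ 2 = 1 + 4 * s + 4 * s ^+ 2); last by ring.
  by rewrite s2; lra.
have s1 : 0 < 1 + 2 * s by rewrite ltr_pwDl// mulr_ge0.
apply: (le_trans (_ : _ <= ln ((1 + 2 * s) ^+ 2))).
  by rewrite ler_ln ?posrE ?invr_gt0 ?rate_q_gt0 ?exprn_gt0.
rewrite lnXn// (_ : 4 * s = (2 * s) *+ 2); last by ring.
by rewrite lerMn2r/= le_ln1Dx//; lra.
Qed.

Lemma inv_ln_rate_q_ge :
  4^-1 * Num.sqrt (Lxy ^+ 2 / (mu_x * mu_y)) <= (ln q^-1)^-1.
Proof.
have -> : Lxy ^+ 2 / (mu_x * mu_y) = a^-1 by rewrite /a invf_div.
rewrite (sqrtrV (ltW (a_gt0))) -invfM lef_pV2 ?posrE ?ln_rate_q_inv_gt0//.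
  exact: ln_rate_q_inv_le.
by rewrite mulr_gt0// sqrtr_gt0.
Qed.

End Rate.

(** * Explicit solution of the recurrence and its decay *)

Section Solution.
Context {R : realType}.
Variables (q : R) (n : nat).
Hypotheses (q_gt0 : 0 < q) (q_lt1 : q < 1).

(* Solution of the recurrence [y_(i-1) + y_(i+1) = (q + q^-1) y_i] with boundary
   conditions [y_(-1) - y_0 = 1] and [y_n = 0]. *)
Definition ysol (i : nat) : R :=
  q / ((1 - q) * (1 + q ^+ (2 * n).+1)) * (q ^+ i - q ^+ (2 * n - i)).

Let alpha_gt0 : 0 < q / ((1 - q) * (1 + q ^+ (2 * n).+1)).
Proof. by rewrite divr_gt0// mulr_gt0 ?subr_gt0// ltr_wpDr// exprn_ge0// ltW. Qed.

Let expq_le i j : (i <= j)%N -> q ^+ j <= q ^+ i.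
Proof. by apply: ler_wiXn2l; rewrite ltW. Qed.

Lemma ysoln : ysol n = 0.
Proof. by rewrite /ysol (_ : (2 * n - n)%N = n) ?subrr ?mulr0//; lia. Qed.

Lemma ysol_nonincr i j : (i <= j)%N -> ysol j <= ysol i.
Proof.
by move=> ij; rewrite (ler_wpM2l (ltW alpha_gt0))// lerB// expq_le//; lia.
Qed.

Lemma ysol_ge0 i : (i <= n)%N -> 0 <= ysol i.
Proof. by move=> /ysol_nonincr; rewrite ysoln. Qed.

(** Both q^i and q^-i solve the recurrence since (1 - q)^2 / q + 2 = q + q^-1, and [ysol] combines
    them. *)
Lemma ysol_step i : (i.+1 < n)%N ->
  (1 - q) ^+ 2 / q * ysol i.+1 + (ysol i.+1 - ysol i.+2) - (ysol i - ysol i.+1)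
  = 0.
Proof.
move=> iN; rewrite /ysol; set al := q / _; set r := (2 * n - i.+2)%N.
have -> : (2 * n - i.+1)%N = r.+1 by rewrite /r; lia.
have -> : (2 * n - i)%N = r.+2 by rewrite /r; lia.
by rewrite !exprS; field; rewrite gt_eqF.
Qed.

(** The prefactor of [ysol] is the normalisation that makes the right side 1. *)
Lemma ysol_first : (0 < n)%N ->
  (1 - q) ^+ 2 / q * ysol 0 + (ysol 0 - ysol 1) = 1.
Proof.
move=> n0; rewrite /ysol subn0 !exprS expr0.
have [r ->] : exists r, (2 * n)%N = r.+1 by exists (2 * n).-1; lia.
rewrite subn1 /= !exprS.
have r0 : 0 < q ^+ r by rewrite exprn_gt0.
have q1 : 0 < 1 - q by rewrite subr_gt0.
field; rewrite !gt_eqF//=.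
by rewrite addr_gt0// !mulr_gt0.
Qed.

(** Both powers in [ysol] contribute to the decrease with the same sign, so no factor 1/2 is lost
    near [n], in contrast to [ysol_shift_ge]. *)
Lemma ysol_diff_ge i m : (i + m < n)%N ->
  (1 - q) * q ^+ m * ysol i <= ysol (i + m) - ysol (i + m).+1.
Proof.
move=> imn; rewrite /ysol; set al := q / _; rewrite -/al -mulrBr.
rewrite mulrCA (ler_wpM2l (ltW alpha_gt0))//.
have -> : (2 * n - (i + m))%N = (2 * n - (i + m).+1).+1 by lia.
rewrite !exprS exprD -subr_ge0; set r := q ^+ (2 * n - _.+1).
rewrite (_ : _ - _ = (1 - q) * (r + q ^+ m * q ^+ (2 * n - i))); last by ring.
have q0 := ltW q_gt0; have q1 : 0 <= 1 - q by rewrite subr_ge0 ltW.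
by rewrite mulr_ge0// addr_ge0// ?mulr_ge0// exprn_ge0.
Qed.

(* With [t = n - i] and [s = n - i - m], [t <= 2s] gives
   [1 - q^(2t) <= 1 - q^(4s) <= 2 (1 - q^(2s))]. *)
Lemma ysol_shift_ge i m : (i + 2 * m <= n)%N ->
  q ^+ m / 2 * ysol i <= ysol (i + m).
Proof.
move=> imn; rewrite /ysol mulrCA (ler_wpM2l (ltW alpha_gt0))//.
set u := q ^+ (2 * (n - i - m)).
have -> : q ^+ (2 * n - (i + m)) = q ^+ i * q ^+ m * u.
  by rewrite /u -!exprD; congr (_ ^+ _); lia.
have le_u : q ^+ i * u ^+ 2 <= q ^+ (2 * n - i).
  by rewrite /u -exprM -exprD expq_le//; lia.
have u1 : u <= 1 by rewrite /u exprn_ile1// ltW.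
have iq : 0 < q ^+ i by rewrite exprn_gt0.
rewrite exprD mulrAC ler_pdivrMr//.
rewrite [leRHS](_ : _ = q ^+ m * (2 * q ^+ i * (1 - u))); last by ring.
rewrite ler_pM2l ?exprn_gt0//.
have : 0 <= q ^+ i * (1 - u) ^+ 2 by rewrite mulr_ge0 ?sqr_ge0// ltW.
by rewrite (_ : q ^+ i * (1 - u) ^+ 2 =
  q ^+ i - 2 * (q ^+ i * u) + q ^+ i * u ^+ 2); [lra|ring].
Qed.

End Solution.

(** By monotonicity the first half of the indices, rounded up, carries at least half of the sum of
    [u]. Since [m] is at most n/4, shifting that half by [m] stays in the range where [v]
    dominates. *)
Lemma tail_sum_ge (R : realType) (u v : nat -> R) (c : R) (n m : nat) :
  (4 * m <= n)%N -> 0 <= c ->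
  (forall i, (i < n)%N -> 0 <= u i) -> (forall i, 0 <= v i) ->
  (forall i j, (i <= j < n)%N -> u j <= u i) ->
  (forall i, (i + m < n)%N -> (i + 2 * m <= n)%N -> c * u i <= v (i + m)%N) ->
  c / 2 * (\sum_(i < n) u i) <= \sum_(i < n | (m <= i)%N) v i.
Proof.
move=> mn c0 u0 v0 umono uv.
set h := uphalf n.
have sum_le (w : nat -> R) k l : (k <= l)%N -> (forall i, (i < l)%N -> 0 <= w i) ->
    \sum_(0 <= i < k) w i <= \sum_(0 <= i < l) w i.
  move=> kl w0; rewrite [leRHS](@big_cat_nat _ _ _ k)//= lerDl big_nat.
  by apply: sumr_ge0 => i /andP[_ /w0].
have le_half : \sum_(0 <= i < n) u i <= 2 * \sum_(0 <= i < h) u i.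
  rewrite (@big_cat_nat _ _ _ h)//=; last by rewrite /h; lia.
  rewrite mulr2n mulrDl !mul1r lerD2l -{1}[h]add0n big_addn.
  apply: (@le_trans _ _ (\sum_(0 <= i < n - h) u i)).
    by apply: ler_sum_nat => i ih; apply: umono; lia.
  apply: sum_le => [|i ih]; first by rewrite /h; lia.
  by apply: u0; rewrite /h in ih; lia.
rewrite -(big_mkord xpredT u).
rewrite -[leRHS](big_geq_mkord m n xpredT v) mulrAC ler_pdivrMr// [leRHS]mulrC.
apply: (le_trans (ler_wpM2l c0 le_half)); rewrite mulrCA ler_pM2l//.
rewrite mulr_sumr -{1}[m]add0n big_addn.
apply: (@le_trans _ _ (\sum_(0 <= i < h) v (i + m)%N)).
  by apply: ler_sum_nat => i ih; apply: uv; rewrite /h in ih; lia.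
by apply: (sum_le (fun i => v (i + m)%N)) => [|i _]; [rewrite /h; lia|exact: v0].
Qed.

(** * Saddle point of the instance and the distance to it *)

Section InstanceBound.
Context {R : realType} {n : nat}.
Variables (mu_x mu_y Lxy : R).
Hypotheses (mu_x_gt0 : 0 < mu_x) (mu_y_gt0 : 0 < mu_y) (Lxy_gt0 : 0 < Lxy).
Hypothesis n_gt0 : (0 < n)%N.

Let q := rate_q mu_x mu_y Lxy.
Let q_gt0 : 0 < q. Proof. exact: rate_q_gt0. Qed.
Let q_lt1 : q < 1. Proof. exact: rate_q_lt1. Qed.

Definition y_opt : 'cV[R]_n := \col_(i < n) ysol (rate_q mu_x mu_y Lxy) n i.

(** Stationarity in x, solved for x. *)
Definition x_opt : 'cV[R]_n := - (Lxy / (2 * mu_x)) *: (Amx R n *m y_opt).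

(** A^2 is a second-difference matrix: its first row gives [ysol_first], the others give
    [ysol_step]. *)
Lemma Amx_sqr_y_opt :
  Amx R n *m (Amx R n *m y_opt) = e1 R n - ((1 - q) ^+ 2 / q) *: y_opt.
Proof.
rewrite /y_opt -/q mul_Amx ?ysoln//.
rewrite (mul_Amx (fun j => ysol q n (n - j.+1) - ysol q n (n - j))); last first.
  (* At [j = n] both truncated subtractions are 0, so the sequence representing A y also vanishes at
     [n]. *)
  by rewrite subnn (eqP (leqnSn n)) subrr.
apply/colP => -[[|i] iN]; rewrite !mxE /=.
  rewrite subn0 !subnn (eqP (leqnSn n)) subrr subr0.
  have -> : (n - (n - 1).+1)%N = 0%N by lia.
  have -> : (n - (n - 1))%N = 1%N by lia.
  by rewrite -[X in _ = X - _](ysol_first _ _ q_gt0 q_lt1 n_gt0); ring.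
have -> : (n - (n - i.+2).+1)%N = i.+1 by lia.
have -> : (n - (n - i.+2))%N = i.+2 by lia.
have -> : (n - (n - i.+1).+1)%N = i by lia.
have -> : (n - (n - i.+1))%N = i.+1 by lia.
by rewrite -[X in _ = X - _](ysol_step _ _ q_gt0 q_lt1 _ iN); ring.
Qed.

Lemma grad_x_opt : inst_C n Lxy *m y_opt = - (mu_x *: x_opt).
Proof.
rewrite /inst_C /x_opt -scalemxAl scalerA -scaleNr; congr (_ *: _).
by field; rewrite gt_eqF.
Qed.

(** The relation (1 - q)^2 / q = 4 mu_x mu_y / Lxy^2 makes the coefficient of [y_opt] equal to
    [mu_y]; the e_0 term is [b]. *)
Lemma grad_y_opt : inst_C n Lxy *m x_opt = mu_y *: y_opt + inst_b n mu_x Lxy.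
Proof.
rewrite /inst_C /x_opt /inst_b -scalemxAl -scalemxAr Amx_sqr_y_opt.
rewrite -rate_q_quadratic// -/q mulfK ?gt_eqF//.
apply/colP => i; rewrite !mxE; field.
by rewrite !gt_eqF.
Qed.

Lemma sqr_enorm_y_opt : enorm y_opt ^+ 2 = \sum_(i < n) ysol q n i ^+ 2.
Proof.
by rewrite sqr_enorm dotE; apply: eq_bigr => i _; rewrite mxE expr2.
Qed.

Lemma x_opt_rev (i : 'I_n) :
  x_opt (rev_ord i) 0 = - (Lxy / (2 * mu_x)) * (ysol q n i - ysol q n i.+1).
Proof. by rewrite mxE mul_Amx_rev ?ysoln. Qed.

Lemma saddle_point_opt xs ys :
  saddle_point (inst_F mu_x mu_y Lxy) xs ys -> xs = x_opt /\ ys = y_opt.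
Proof.
rewrite /inst_F inst_fE inst_gE => sp.
exact: (saddle_point_unique _ _ _ _ mu_x_gt0 mu_y_gt0 _ _ (trmx_inst_C _)
  grad_x_opt grad_y_opt _ _ sp).
Qed.

(* For even [k] the missing coordinates of [yt] suffice; for odd [k] the power
   [q ^+ k] is only reached through the missing coordinates of [xt]. *)
Lemma dist_opt_ge k (xt yt : 'cV[R]_n) : (4 * k <= n)%N ->
  supp (fun i => n <= i + k./2)%N xt -> supp (fun i => i < uphalf k)%N yt ->
  mu_y / 32 * q ^+ k * enorm y_opt ^+ 2 <=
  mu_x / 2 * dot (xt - x_opt) (xt - x_opt) +
  mu_y / 2 * dot (yt - y_opt) (yt - y_opt).
Proof.
move=> kn sx sy; rewrite sqr_enorm_y_opt.
have mx2 : 0 < mu_x / 2 by rewrite divr_gt0.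
have my2 : 0 < mu_y / 2 by rewrite divr_gt0.
have y2_ge0 i : 0 <= ysol q n i ^+ 2 by exact: sqr_ge0.
have y2_mono i j : (i <= j < n)%N -> ysol q n j ^+ 2 <= ysol q n i ^+ 2.
  case/andP=> ij jn; have yj : 0 <= ysol q n j by apply: ysol_ge0; lia.
  by rewrite lerXn2r ?nnegrE//; [apply: le_trans yj _|]; exact: ysol_nonincr.
set m := k./2; have mn : (4 * m <= n)%N by rewrite /m; lia.
have kE := odd_double_half k; rewrite -/m in kE.
have S_ge0 : 0 <= \sum_(i < n) ysol q n i ^+ 2 by apply: sumr_ge0.
case: (odd k) kE => /= kE.
  have qk : q ^+ k = q * (q ^+ m) ^+ 2.
    by rewrite -kE add1n exprS -muln2 exprM.
  apply: ler_wpDr; first by rewrite mulr_ge0 ?dot_ge0// ltW.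
  apply: le_trans (ler_wpM2l (ltW mx2) (dot_sub_supp _ x_opt _ sx)).
  (* Reversal turns the entries of [x_opt] into differences of [ysol], and the missing coordinates
     into the indices from [m] on. *)
  rewrite -/m [in leRHS](reindex_inj rev_ord_inj) /=.
  under [in leRHS]eq_bigr do rewrite x_opt_rev exprMn.
  rewrite -mulr_sumr.
  have -> : \sum_(i < n | ~~ (n <= n - i.+1 + m)%N)
      (ysol q n i - ysol q n i.+1) ^+ 2 =
    \sum_(i < n | (m <= i)%N) (ysol q n i - ysol q n i.+1) ^+ 2.
    by apply: eq_bigl => i; have := ltn_ord i; lia.
  have := @tail_sum_ge _ (fun i => ysol q n i ^+ 2)
    (fun i => (ysol q n i - ysol q n i.+1) ^+ 2) (((1 - q) * q ^+ m) ^+ 2) n m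
    mn (sqr_ge0 _) (fun i _ => y2_ge0 i) (fun i => sqr_ge0 _) y2_mono.
  set S := \sum_(i < n) _; set T := \sum_(i < n | _) _.
  have d_ge i : (i + m < n)%N -> (i + 2 * m <= n)%N ->
      ((1 - q) * q ^+ m) ^+ 2 * ysol q n i ^+ 2 <=
      (ysol q n (i + m)%N - ysol q n (i + m).+1) ^+ 2.
    move=> imn _; rewrite -exprMn; have y0 : 0 <= ysol q n i.
      by apply: ysol_ge0 => //; lia.
    have q0 := ltW q_gt0; have q1 : 0 <= 1 - q by rewrite subr_ge0 ltW.
    have yq0 : 0 <= (1 - q) * q ^+ m * ysol q n i.
      by rewrite (mulr_ge0 _ y0)// mulr_ge0// exprn_ge0.
    have le_d := ysol_diff_ge _ _ q_gt0 q_lt1 _ _ imn.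
    by rewrite ler_sqr ?nnegrE// (le_trans yq0).
  move=> /(_ d_ge) ST; have ax0 : 0 < Lxy ^+ 2 / (8 * mu_x).
    by rewrite divr_gt0 ?exprn_gt0 ?mulr_gt0.
  have -> : mu_x / 2 * ((- (Lxy / (2 * mu_x))) ^+ 2 * T) =
      Lxy ^+ 2 / (8 * mu_x) * T by field; rewrite gt_eqF.
  apply: le_trans (ler_wpM2l (ltW ax0) ST).
  (* Replacing (1 - q)^2 by 4 a q supplies the odd factor q and trades the weight [mu_x] for
     [mu_y]. *)
  rewrite exprMn -rate_q_quadratic// -/q.
  have -> : Lxy ^+ 2 / (8 * mu_x) *
      (4 * (mu_x * mu_y / Lxy ^+ 2) * q * (q ^+ m) ^+ 2 / 2 * S) =
      mu_y / 4 * q ^+ k * S.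
    rewrite qk; field.
    by rewrite !gt_eqF.
  (* The factor is 1/4 here and 1/16 for even [k]; 1/32 covers both. *)
  by rewrite ler_wpM2r// ler_pM2r ?exprn_gt0// ler_pM2l// lef_pV2 ?posrE// ler_nat.
have qk : q ^+ k = (q ^+ m) ^+ 2 by rewrite -kE add0n -muln2 exprM.
apply: ler_wpDl; first by rewrite mulr_ge0 ?dot_ge0// ltW.
apply: le_trans (ler_wpM2l (ltW my2) (dot_sub_supp _ y_opt _ sy)).
have -> : \sum_(i < n | ~~ (i < uphalf k)%N) y_opt i 0 ^+ 2 =
    \sum_(i < n | (m <= i)%N) ysol q n i ^+ 2.
  by apply: eq_big => i; rewrite ?mxE//; lia.
have := @tail_sum_ge _ (fun i => ysol q n i ^+ 2)
  (fun i => ysol q n i ^+ 2) ((q ^+ m / 2) ^+ 2) n m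
  mn (sqr_ge0 _) (fun i _ => y2_ge0 i) (fun i => sqr_ge0 _) y2_mono.
set T := \sum_(i < n | _) _; set S := \sum_(i < n) _ in S_ge0 *.
have y_ge i : (i + m < n)%N -> (i + 2 * m <= n)%N ->
    (q ^+ m / 2) ^+ 2 * ysol q n i ^+ 2 <= ysol q n (i + m)%N ^+ 2.
  move=> _ imn; rewrite -exprMn; have y0 : 0 <= ysol q n i.
    by apply: ysol_ge0 => //; lia.
  have yq0 : 0 <= q ^+ m / 2 * ysol q n i.
    by rewrite mulr_ge0// divr_ge0// exprn_ge0// ltW.
  have le_y := ysol_shift_ge _ _ q_gt0 q_lt1 _ _ imn.
  by rewrite ler_sqr ?nnegrE// (le_trans yq0).
move=> /(_ y_ge) ST; apply: le_trans (ler_wpM2l (ltW my2) ST).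
have -> : mu_y / 2 * ((q ^+ m / 2) ^+ 2 / 2 * S) = mu_y / 16 * q ^+ k * S.
  by rewrite qk; field.
by rewrite ler_wpM2r// ler_pM2r ?exprn_gt0// ler_pM2l// lef_pV2 ?posrE// ler_nat.
Qed.

Lemma iter_bound_le k eps (xt yt : 'cV[R]_n) : (4 * k <= n)%N -> 0 < eps ->
  supp (fun i => n <= i + k./2)%N xt -> supp (fun i => i < uphalf k)%N yt ->
  (duality_gap (inst_F mu_x mu_y Lxy) xt yt <= eps%:E)%E ->
  iter_bound mu_x mu_y Lxy eps y_opt 0 <= k%:R.
Proof.
move=> kn eps0 sx sy; rewrite /inst_F inst_fE inst_gE => gap.
have := duality_gap_ge _ _ _ _ _ _ (trmx_inst_C _)
  grad_x_opt grad_y_opt _ _ _ gap.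
move=> /(le_trans (dist_opt_ge k xt yt kn sx sy)).
rewrite /iter_bound subr0 -/q; set Y := enorm y_opt ^+ 2 => le_eps.
rewrite ler_pdivrMr ?ln_rate_q_inv_gt0//.
have Y0 : 0 <= mu_y * Y / (32 * eps).
  by apply: divr_ge0; apply: mulr_ge0; rewrite ?(ltW mu_y_gt0) ?(ltW eps0) ?sqr_ge0.
(* The degenerate case of argument 0 is settled by the convention [ln 0 = 0]. *)
move: Y0; rewrite le_eqVlt => /predU1P[<-|Y0].
  by rewrite ln0// mulr_ge0// ltW// ln_rate_q_inv_gt0.
rewrite [leRHS]mulr_natl -lnXn ?invr_gt0//.
rewrite ler_ln ?posrE ?exprn_gt0 ?invr_gt0//.
rewrite exprVn ler_pdivrMr ?mulr_gt0//.
rewrite ler_pdivlMl ?exprn_gt0//.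
by move: le_eps; rewrite -(ler_pM2l (_ : 0 < 32))//; apply: le_trans;
  rewrite le_eqVlt; apply/orP; left; apply/eqP; field.
Qed.

End InstanceBound.

(** * The iteration bound as eps tends to 0 *)

Lemma enorm_y_opt_ge (R : realType) (n : nat) (mu_x mu_y Lxy : R) :
  0 < mu_x -> 0 < mu_y -> 0 < Lxy -> (0 < n)%N ->
  rate_q mu_x mu_y Lxy ^+ 2 / 4 <= enorm (@y_opt R n mu_x mu_y Lxy) ^+ 2.
Proof.
move=> mx0 my0 L0; case: n => // n _; rewrite sqr_enorm_y_opt.
set q := rate_q _ _ _.
have q_gt0 : 0 < q by exact: rate_q_gt0.
have q_lt1 : q < 1 by exact: rate_q_lt1.
(* Coordinate 0 alone gives a bound free of the dimension, because 1 - q^(2n) >= 1 - q and 1 +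
   q^(2n+1) <= 2; this later makes [eps0] uniform. *)
rewrite big_ord_recl; apply: ler_wpDr; first by apply: sumr_ge0 => i _; exact: sqr_ge0.
have -> : q ^+ 2 / 4 = (q / 2) ^+ 2 by field.
have q20 : 0 <= q / 2 by rewrite divr_ge0// ltW.
suff y0 : q / 2 <= ysol q n.+1 0 by rewrite ler_sqr ?nnegrE// (le_trans q20).
have q1 : 0 < 1 - q by rewrite subr_gt0.
rewrite /ysol subn0 expr0.
have le1 k : (0 < k)%N -> q ^+ k <= q.
  by move=> k0; rewrite -[leRHS]expr1 ler_wiXn2l// ltW.
have u0 : 0 < 1 + q ^+ (2 * n.+1).+1 by rewrite ltr_pwDl// exprn_ge0// ltW.
rewrite -mulrA ler_pM2l// mulrC ler_pdivlMr ?mulr_gt0//.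
have := le1 (2 * n.+1)%N isT; have := le1 (2 * n.+1).+1 isT.
set u := q ^+ _.+1; set v := q ^+ _ => uq vq.
have : (1 - q) * u <= 1 - q by rewrite ger_pMr//; lra.
lra.
Qed.

(* The four conjuncts: membership of the instance in the class; the lower bound
   on k; the absolute-constant bound on 1 / ln (1 / q); and the resulting
   asymptotic bound as eps -> 0, uniform in the dimension n. *)
Theorem proposition3p6 (R : realType) :
  exists2 c : R, 0 < c &
  forall mu_x mu_y Lxy : R, 0 < mu_x -> 0 < mu_y -> 0 < Lxy ->
  [/\ forall n : nat, (0 < n)%N ->
        in_class_B Lxy mu_x mu_y
          (@inst_f R n mu_x) (inst_g mu_x mu_y Lxy) (inst_C n Lxy),
      forall (n k : nat), (0 < n)%N ->
        Num.max (2 * logb (rate_q mu_x mu_y Lxy)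
                       (mu_x * mu_y / (Num.sqrt 2 * Lxy ^+ 2)))
                (4 * k%:R) <= n%:R ->
        forall xs ys : 'cV[R]_n, saddle_point (inst_F mu_x mu_y Lxy) xs ys ->
        forall (gamma sigma : nat -> R) (x y : nat -> 'cV[R]_n)
               (Hx Hy : nat -> set 'cV[R]_n),
        proximal_span_run (@inst_f R n mu_x) (inst_g mu_x mu_y Lxy)
          (inst_C n Lxy) gamma sigma x y Hx Hy ->
        x 0%N = 0 -> y 0%N = 0 ->
        forall (xt yt : 'cV[R]_n) (eps : R), 0 < eps -> Hx k xt -> Hy k yt ->
        (duality_gap (inst_F mu_x mu_y Lxy) xt yt <= eps%:E)%E ->
        iter_bound mu_x mu_y Lxy eps ys (y 0%N) <= k%:R,
      c * Num.sqrt (Lxy ^+ 2 / (mu_x * mu_y)) <=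
        (ln (rate_q mu_x mu_y Lxy)^-1)^-1
    & exists2 eps0 : R, 0 < eps0 &
        forall (n : nat) (xs ys : 'cV[R]_n) (eps : R), (0 < n)%N ->
        saddle_point (inst_F mu_x mu_y Lxy) xs ys -> 0 < eps < eps0 ->
        c * (Num.sqrt (Lxy ^+ 2 / (mu_x * mu_y)) * ln eps^-1) <=
          iter_bound mu_x mu_y Lxy eps ys 0].
Proof.
(* The 1/4 of [inv_ln_rate_q_ge], halved by the loss inside the logarithm. *)
exists 8^-1 => // mu_x mu_y Lxy mx0 my0 L0.
have le_rate := inv_ln_rate_q_ge _ _ _ mx0 my0 L0.
have lnq := ln_rate_q_inv_gt0 _ _ _ mx0 my0 L0.
have q0 := rate_q_gt0 _ _ _ mx0 my0 L0.
split.
- by move=> n _; exact: inst_in_class_B.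
- move=> n k n0; rewrite ge_max -natrM ler_nat => /andP[_ kn] xs ys.
  move=> /(saddle_point_opt _ _ _ mx0 my0 L0 n0)[_ ->].
  move=> gamma sigma x y Hx Hy run x0 y0 xt yt eps eps0 Hxt Hyt.
  have [sx sy] := span_run_supp _ _ _ mx0 my0 L0 _ _ _ _ _ _ run x0 y0 k.
  by rewrite y0; apply: iter_bound_le => //; [exact: sx|exact: sy].
- by apply: le_trans le_rate; rewrite ler_wpM2r ?sqrtr_ge0// lef_pV2 ?posrE// ler_nat.
set q := rate_q _ _ _ in lnq q0 le_rate *.
(* For [eps < K ^+ 2] the constant factor [K] inside the logarithm costs at most
   half of [ln eps^-1]. *)
pose K := mu_y * (q ^+ 2 / 4) / 32.
have K0 : 0 < K by rewrite divr_gt0// mulr_gt0// divr_gt0// exprn_gt0.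
exists (Num.min 1 (K ^+ 2)); first by rewrite lt_min ltr01 exprn_gt0.
move=> n xs ys eps n0 /(saddle_point_opt _ _ _ mx0 my0 L0 n0)[_ ->].
rewrite lt_min => /and3P[eps0 eps1 epsK].
rewrite /iter_bound subr0 -/q ler_pdivlMr//.
have le_Y := enorm_y_opt_ge _ _ _ _ _ mx0 my0 L0 n0.
set Y := enorm _ ^+ 2 in le_Y *.
have lneps : 0 <= ln eps^-1 by rewrite ln_ge0// invf_ge1// ltW.
apply: (@le_trans _ _ (2^-1 * ln eps^-1)).
  set s := Num.sqrt _ in le_rate *.
  have : 4^-1 * s * ln q^-1 <= 1 by rewrite -ler_pdivlMr// div1r.
  move=> /(ler_wpM2r lneps); rewrite mul1r => le1.
  rewrite -(ler_pM2l (_ : 0 < 2 :> R))// [leRHS]mulVKf//.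
  by apply: le_trans le1; rewrite le_eqVlt; apply/orP; left; apply/eqP; field.
have KY : K / eps <= mu_y * Y / (32 * eps).
  by rewrite invfM mulrA ler_pM2r ?invr_gt0// ler_pM2r ?invr_gt0// ler_pM2l//.
have Ke : 0 < K / eps by rewrite divr_gt0.
apply: (@le_trans _ _ (ln (K / eps))); last first.
  by rewrite ler_ln ?posrE// (lt_le_trans Ke).
(* Doubling and removing the logarithms leaves eps^-1 <= (K / eps)^2, that is eps <= K^2. *)
rewrite mulrC ler_pdivrMr// [leRHS]mulrC [leRHS]mulr_natl -(lnXn _ Ke).
rewrite ler_ln ?posrE ?invr_gt0// ?(exprn_gt0 _ Ke)//.
rewrite expr_div_n ler_pdivlMr ?exprn_gt0//.
by rewrite [X in _ * X]expr2 mulKf ?gt_eqF// ltW.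
Qed.
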